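(* Let $G$ be a finite group or a compact Lie group, let $\mathcal{H}_B$ be a Hilbert space of finite dimension $d$ with orthonormal basis $\{|i\rangle\}_{i=1}^d$, and let $\mathcal{R},\mathcal{L}$ be projective unitary representations of $G$ on $\mathcal{H}_B$ with inverse multipliers $\gamma$ and $\gamma^{-1}$ respectively. Let $B$ be a tensor consisting of $D_2\times D_1$ matrices $\{B^i\}_{i=1}^d$, and let $X(g)$ (of size $D_1\times D_1$) and $Y(g)$ (of size $D_2\times D_2$), $g\in G$, be matrices such that for all $g\in G$ and all $i=1,\dots,d$ $$\sum_{i'}\mathcal{R}(g)_{i,i'}B^{i'}=B^iX(g),\qquad\sum_{i'}\mathcal{L}(g)_{i,i'}B^{i'}=Y(g)^{-1}B^i .$$ Then the Hilbert space $\mathcal{H}_B$ can be restricted to a representation space of $G\times G$ and thus decomposes into a direct sum of tensor products of irreducible representation spaces of $G$: $$\mathcal{H}_B=\bigoplus_{k=1}^M\mathcal{H}_{l_k}\otimes\mathcal{H}_{r_k},$$ where $r_k$ and $l_k$ are irreducible representation labels.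
   Context: A multiplier of $G$ is a function $\gamma:G\times G\to U(1)$ with $\gamma(g,h)\gamma(gh,f)=\gamma(g,hf)\gamma(h,f)$ and $\gamma(g,e)=\gamma(e,g)=1$ for all $g,h,f\in G$ (required to be continuous if $G$ is a compact Lie group). A projective unitary representation of $G$ with multiplier $\gamma$ on a finite-dimensional Hilbert space is a map $\Theta$ from $G$ to the unitary operators with $\Theta(g)\Theta(h)=\gamma(g,h)\Theta(gh)$ for all $g,h\in G$. All representations are unitary and finite dimensional, and ''representation'' here includes projective representations. Matrix elements are $\mathcal{R}(g)_{i,i'}=\langle i|\mathcal{R}(g)|i'\rangle$, and similarly for $\mathcal{L}$. The tensor $B$ is used, alone (when $D_1=D_2$) or alternating with another tensor $A$ of $D_1\times D_2$ matrices, to generate matrix product vectors, whose coefficients in the product basis are traces of products of the matrices; $\mathcal{H}_B$ is the local Hilbert space at each site carrying $B$. ''Can be restricted'' means that $\mathcal{H}_B$ may be replaced by a subspace that suffices to describe these matrix product vectors; the displayed decomposition is for $\mathcal{H}_B$ after this restriction. *)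

(* Defs.v *)
(* MathComp world: MathComp, MathComp-Analysis and MathComp-Real-Closed. *)
From HB Require Import structures.
From mathcomp Require Import all_boot all_order all_algebra.
From mathcomp Require Import all_classical all_reals all_analysis.
From mathcomp Require Import complex mxtens.

Set Implicit Arguments.
Unset Strict Implicit.
Unset Printing Implicit Defensive.

Import Order.TTheory GRing.Theory Num.Theory.
Import numFieldNormedType.Exports.
Local Open Scope classical_set_scope.
Local Open Scope ring_scope.
Local Open Scope sesquilinear_scope.

(* A group and a topology on the same carrier, with no compatibility axiom;
   continuity of the operations is part of [lie_group]. *)
#[short(type="topGroupType")]
HB.structure Definition TopGroup := {G of Group G & Topological G}.

Fixpoint Ck (R : realType) (V W : normedModType R) (k : nat)
    (U : set V) (f : V -> W) : Prop :=
  match k with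
  | 0 => forall x, U x -> {for x, continuous f}
  | k'.+1 => (forall x v, U x -> derivable f x v) /\
             (forall v, Ck k' U ('D_v f))
  end.

(* Only used for U open, so that the values of f outside U do not matter. *)
Definition smooth_on (R : realType) (V W : normedModType R)
    (U : set V) (f : V -> W) : Prop := forall k, Ck k U f.

Record chart (R : realType) (n : nat) (G : Type) := Chart {
  chart_dom : set G;
  coord : G -> 'rV[R]_n;
  param : 'rV[R]_n -> G
}.

Definition chart_img (R : realType) (n : nat) (G : Type) (c : chart R n G) :
  set 'rV[R]_n := coord c @` chart_dom c.

Definition is_chart (R : realType) (n : nat) (G : topologicalType)
    (c : chart R n G) : Prop :=
  [/\ open (chart_dom c), open (chart_img c),
      (forall x, chart_dom c x -> param c (coord c x) = x),
      (forall x, chart_dom c x -> {for x, continuous (coord c)})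
    & (forall y, chart_img c y -> {for y, continuous (param c)})].

Definition smooth_atlas (R : realType) (n : nat) (G : topologicalType)
    (A : set (chart R n G)) : Prop :=
  [/\ (forall c, A c -> is_chart c),
      (forall x, exists2 c, A c & chart_dom c x)
    & (forall c c', A c -> A c' ->
        smooth_on (coord c @` (chart_dom c `&` chart_dom c'))
                  (coord c' \o param c))].

Definition smooth_group_ops (R : realType) (n : nat) (G : topGroupType)
    (A : set (chart R n G)) : Prop :=
  (forall c1 c2 c3, A c1 -> A c2 -> A c3 ->
     smooth_on
       [set z : 'rV[R]_n * 'rV[R]_n |
          [/\ chart_img c1 z.1, chart_img c2 z.2
            & chart_dom c3 (param c1 z.1 * param c2 z.2)%g]]
       (fun z => coord c3 (param c1 z.1 * param c2 z.2)%g)) /\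
  (forall c1 c2, A c1 -> A c2 ->
     smooth_on
       [set y : 'rV[R]_n | chart_img c1 y /\ chart_dom c2 (param c1 y)^-1%g]
       (fun y => coord c2 (param c1 y)^-1%g)).

Definition lie_group (R : realType) (G : topGroupType) : Prop :=
  [/\ hausdorff_space G, @second_countable G,
      continuous (fun p : G * G => (p.1 * p.2)%g),
      continuous (fun g : G => g^-1%g)
    & exists n (A : set (chart R n G)), smooth_atlas A /\ smooth_group_ops A].

Definition compact_lie_group (R : realType) (G : topGroupType) : Prop :=
  lie_group R G /\ compact [set: G].

(* Continuity into the complex numbers is continuity of both components. *)
Definition multiplier (R : realType) (G : topGroupType)
    (gam : G -> G -> R[i]) : Prop :=
  [/\ (forall g h, `|gam g h| = 1),
      (forall g h f, gam g h * gam (g * h)%g f = gam g (h * f)%g * gam h f),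
      (forall g, gam g 1%g = 1 /\ gam 1%g g = 1)
    & (compact_lie_group R G ->
         continuous (fun p : G * G => complex.Re (gam p.1 p.2)) /\
         continuous (fun p : G * G => complex.Im (gam p.1 p.2)))].

Section Representations.
Variables (R : realType) (G : groupType).
Local Notation C := R[i].

(* Operators act on column vectors; 'cV[C]_n carries its standard Hermitian
   product, and Theta g i j is the matrix element <i|Theta(g)|j>. *)
Definition proj_unitary_rep (n : nat) (gam : G -> G -> C)
    (Theta : G -> 'M[C]_n) : Prop :=
  (forall g, Theta g \is unitarymx) /\
  (forall g h, Theta g *m Theta h = gam g h *: Theta (g * h)%g).

Definition stable (n : nat) (V : {vspace 'cV[C]_n})
    (Theta : G -> 'M[C]_n) : Prop :=
  forall g v, v \in V -> Theta g *m v \in V.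

(* V is invariant under Theta, and the restriction of Theta to V is a
   projective unitary representation with multiplier gam, although Theta need
   not be one on the whole space. *)
Definition restricts_to_proj_unitary_rep (n : nat) (V : {vspace 'cV[C]_n})
    (gam : G -> G -> C) (Theta : G -> 'M[C]_n) : Prop :=
  [/\ (forall g, Theta g \is unitarymx), stable V Theta
    & (forall g h v, v \in V ->
         Theta g *m (Theta h *m v) = gam g h *: (Theta (g * h)%g *m v))].

Definition irreducible_rep (n : nat) (Theta : G -> 'M[C]_n) : Prop :=
  (0 < n)%N /\
  (forall V : {vspace 'cV[C]_n}, stable V Theta -> V = 0%VS \/ V = fullv).

End Representations.

Definition orthonormal_basis (R : realType) (d m : nat)
    (V : {vspace 'cV[R[i]]_d}) (W : 'M[R[i]]_(d, m)) : Prop :=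
  W^t* *m W = 1%:M /\ (forall v, v \in V <-> exists x : 'cV_m, v = W *m x).

Section MatrixProductVectors.
Variable R : realType.
Local Notation C := R[i].

(* Vectors of an N-site system are given by their coefficients in the product
   basis, indexed by N.-tuple I. *)
Definition mpv (D d N : nat) (B : 'I_d -> 'M[C]_D) (s : N.-tuple 'I_d) : C :=
  \tr (\prod_(n < N) B (tnth s n)).

Definition alternating_mpv (D1 D2 dA d N : nat) (A : 'I_dA -> 'M[C]_(D1, D2))
    (B : 'I_d -> 'M[C]_(D2, D1)) (s : N.-tuple ('I_dA * 'I_d)) : C :=
  \tr (\prod_(n < N) (A (tnth s n).1 *m B (tnth s n).2)).

(* psi is a linear combination of product vectors with all factors in S. *)
Definition in_tensor_power (I : finType) (N : nat) (S : set (I -> C))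
    (psi : N.-tuple I -> C) : Prop :=
  exists K (c : 'I_K -> C) (v : 'I_K -> 'I_N -> I -> C),
    (forall k n, S (v k n)) /\
    (forall s, psi s = \sum_(k < K) c k * \prod_(n < N) v k n (tnth s n)).

Definition local_vectors (d : nat) (V : {vspace 'cV[C]_d}) : set ('I_d -> C) :=
  [set x | exists2 v, v \in V & x = (fun i => v i 0)].

(* The span of these is H_A (x) V. *)
Definition block_vectors (dA d : nat) (V : {vspace 'cV[C]_d}) :
    set ('I_dA * 'I_d -> C) :=
  [set x | exists u : 'cV[C]_dA, exists2 v, v \in V &
             x = (fun p => u p.1 0 * v p.2 0)].

(* Every matrix product vector generated by B, alone when D1 = D2 or
   alternating with an arbitrary tensor A, lies in the tensor product in which
   the local space of each site carrying B is replaced by V. *)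
Definition suffices_for_mpv (D1 D2 d : nat) (B : 'I_d -> 'M[C]_(D2, D1))
    (V : {vspace 'cV[C]_d}) : Prop :=
  (forall (e : D1 = D2) N,
     in_tensor_power (local_vectors V)
       (@mpv D2 d N (fun i => castmx (erefl D2, e) (B i)))) /\
  (forall dA (A : 'I_dA -> 'M[C]_(D1, D2)) N,
     in_tensor_power (@block_vectors dA d V) (@alternating_mpv D1 D2 dA d N A B)).

End MatrixProductVectors.

(* Main.v *)
(* Let V be the span of the vectors v_ab = (B^i_ab)_i. On V the action of R is
   right multiplication of B by X and the action of L is left multiplication by
   Y^-1, so V is stable and the two actions commute on it; unitarity makes the
   projector P onto V commute with both.

   Tensor factors are then split off P one at a time. Take an irreducible
   R-subrepresentation r in the range of P. The intertwiners T from r to R with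
   range in that of P are carried to one another by L, and by Schur's lemma
   T^* T' is always a scalar, so that T |-> T e0 is isometric for a unit vector
   e0. Among the vectors T e0 choose an irreducible L-subrepresentation l with
   orthonormal basis T_j e0; then e_j (x) x |-> T_j x embeds l (x) r
   isometrically, and its range is removed from P. *)
Require Import Defs.
From HB Require Import structures.
From mathcomp Require Import all_boot all_order all_algebra.
From mathcomp Require Import all_classical all_reals all_analysis.
From mathcomp Require Import complex mxtens.

Import Order.TTheory GRing.Theory Num.Theory.
Import numFieldNormedType.Exports.
Local Open Scope classical_set_scope.
Local Open Scope ring_scope.
Local Open Scope sesquilinear_scope.

(** * Adjoints, orthonormal bases and subspaces *)

Lemma adjmxM {C : numClosedFieldType} {m n p : nat} (A : 'M[C]_(m, n))
    (B : 'M[C]_(n, p)) : (A *m B)^t* = B^t* *m A^t*.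
Proof. by rewrite trmx_mul map_mxM. Qed.

Lemma adjmx_mul_eq0 {C : numClosedFieldType} {m n : nat} (A : 'M[C]_(m, n)) :
  A^t* *m A = 0 -> A = 0.
Proof.
move=> A0; apply/matrixP => i j; rewrite mxE.
have /eqP := congr1 (fun M => fun_of_matrix M j j) A0; rewrite !mxE psumr_eq0.
  by move=> /allP /(_ i (mem_index_enum i)); rewrite !mxE mulf_eq0 conjC_eq0 orbb => /eqP.
by move=> k _; rewrite !mxE mulrC mul_conjC_ge0.
Qed.

Lemma eq_mulmx_cV {C : pzRingType} {m n : nat} (A B : 'M[C]_(m, n)) :
  (forall x : 'cV_n, A *m x = B *m x) -> A = B.
Proof.
move=> AB; apply: trmx_inj; apply/row_matrixP => j.
by rewrite -!tr_col !colE AB.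
Qed.

(** Unitarity of [A] and [t^t* t = 1] give [a^t* a = 1], hence also [a a^t* = 1] because [a] is
    square. Conjugating the projector [t t^t*] by [A] therefore yields [t a a^t* t^t*], the same
    projector. *)
Lemma isometry_intertwiner {C : numClosedFieldType} {d n : nat}
    {A : 'M[C]_d} {t : 'M[C]_(d, n)} {a : 'M[C]_n} :
  A \is unitarymx -> t^t* *m t = 1%:M -> A *m t = t *m a ->
  a \is unitarymx /\ A *m (t *m t^t*) = t *m t^t* *m A.
Proof.
move=> Au tt At; have Au' : A^t* *m A = 1%:M.
  by rewrite -[X in _ *m X](trmxCK A); apply/unitarymxP; rewrite trmxC_unitary.
have aa : a^t* *m a = 1%:M.
  rewrite -[a in _ *m a]mul1mx -tt -mulmxA -At !mulmxA -adjmxM -At adjmxM.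
  by rewrite -[_ *m A^t* *m A]mulmxA Au' mulmx1.
have aa' : a *m a^t* = 1%:M by apply: mulmx1C.
split; first exact/unitarymxP.
have E : A *m (t *m t^t*) *m A^t* = t *m t^t*.
  rewrite mulmxA At -[_ *m A^t*]mulmxA -adjmxM At adjmxM mulmxA.
  by rewrite -[t *m a *m _]mulmxA aa' mulmx1.
by rewrite -{2}E -[in RHS]mulmxA Au' mulmx1.
Qed.

(* The vectors of [V] are transposed because [schmidt] works on row spaces. *)
Lemma ex_orthonormal_basis {R : realType} {d : nat} (V : {vspace 'cV[R[i]]_d}) :
  exists n (t : 'M[_]_(d, n)), orthonormal_basis V t.
Proof.
pose b := \matrix_(i < \dim V) ((vbasis V)`_i)^T.
have bP v : (v \in V) <-> (v^T <= b)%MS.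
  split=> [Vv|/submxP[x vE]].
    rewrite (coord_vbasis Vv) linear_sum /=; apply: summx_sub => i _.
    rewrite linearZ /= scalemx_sub //.
    by rewrite -[X in (X <= _)%MS](rowK (fun i => ((vbasis V)`_i)^T)) row_sub.
  have -> : v = \sum_i x 0 i *: (vbasis V)`_i.
    apply: trmx_inj; rewrite vE mulmx_sum_row linear_sum /=; apply: eq_bigr => i _.
    by rewrite linearZ /= rowK.
  by apply: memv_suml => i _; rewrite memvZ // vbasis_mem // mem_nth // size_tuple.
pose s := schmidt (row_base b).
have su : s \is unitarymx by apply: schmidt_unitarymx; apply: rank_leq_col.
have sb : (s :=: b)%MS.
  exact: eqmx_trans (eqmx_schmidt_free (row_base_free b)) (eq_row_base b).
exists (\rank b), s^T; split.
  have /unitarymxP /(congr1 (fun M => map_mx Num.conj M)) := su.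
  rewrite map_mxM map_mx1 /= => <-; congr (_ *m _); rewrite ?trmxK //.
  by apply/matrixP => i j; rewrite !mxE conjCK.
move=> v; split=> [/bP|[x ->]].
  rewrite -sb => /submxP[x vE]; exists x^T.
  by rewrite -trmx_mul -vE trmxK.
by apply/bP; rewrite -sb trmx_mul trmxK submxMl.
Qed.

(** Among the subspaces contained in [p], one of maximal dimension contains every vector of [p]:
    adding the line through such a vector does not leave [p]. *)
Lemma vspace_of_pred {F : fieldType} {vT : vectType F} (p : vT -> Prop) :
  p 0 -> (forall a u v, p u -> p v -> p (a *: u + v)) ->
  exists V : {vspace vT}, forall v, v \in V <-> p v.
Proof.
move=> p0 pD.
pose Q n := `[< exists V : {vspace vT}, \dim V = n /\ forall v, v \in V -> p v >].
have exQ : exists n, Q n.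
  exists 0%N; apply/asboolP; exists 0%VS; rewrite dimv0; split=> // v.
  by rewrite memv0 => /eqP ->.
have Qle n : Q n -> (n <= \dim {:vT})%N.
  by move=> /asboolP [V [<- _]]; apply/dimvS/subvf.
case: (ex_maxnP exQ Qle) => n /asboolP [V [dimV Vp]] maxV.
exists V => v; split=> [/Vp //|pv].
suff -> : V = (<[v]> + V)%VS by rewrite memvE addvSl.
apply/eqP; rewrite eqEdim addvSr dimV; apply: maxV; apply/asboolP.
exists (<[v]> + V)%VS; split=> // w /memv_addP [x /vlineP [a ->]] [y Vy ->].
exact/pD/Vp.
Qed.

(** * Irreducible subrepresentations and Schur's lemma *)

Lemma ex_minimal_stable {R : realType} {G : groupType} {d : nat}
    {F : G -> 'M[R[i]]_d} {V : {vspace 'cV[R[i]]_d}} :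
  V <> 0%VS -> stable V F ->
  exists U : {vspace 'cV[R[i]]_d}, [/\ U <> 0%VS, (U <= V)%VS, stable U F &
    forall U', (U' <= U)%VS -> stable U' F -> U' = 0%VS \/ U' = U].
Proof.
have [n] := ubnP (\dim V); elim: n V => // n IHn V ltVn V0 VF.
have [[U [UV UF U0 neqUV]]|noU] := pselect (exists U : {vspace 'cV_d},
    [/\ (U <= V)%VS, stable U F, U <> 0%VS & U <> V]); last first.
  exists V; split=> // U UV UF.
  have [->|/eqP U0] := eqVneq U 0%VS; [by left|right].
  by apply: contrapT => UnV; apply: noU; exists U.
have ltUV : (\dim U < \dim V)%N.
  rewrite ltn_neqAle dimvS // andbT; apply/eqP => eqd; apply: neqUV.
  by apply/eqP; rewrite eqEdim UV eqd /=.
have [W [W0 WU WF Wmin]] := IHn U (leq_trans ltUV ltVn) U0 UF.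
by exists W; split=> //; apply: subv_trans UV.
Qed.

(** The columns of [t] are an orthonormal basis of a minimal stable subspace, and [a] is the
    compression of [F] to it. Subspaces stable under [a] are carried by [t] to subspaces stable
    under [F], so minimality becomes irreducibility. *)
Lemma ex_irreducible_subrep {R : realType} {G : groupType} {d : nat}
    {F : G -> 'M[R[i]]_d} {V : {vspace 'cV[R[i]]_d}} :
  V <> 0%VS -> stable V F ->
  exists n (t : 'M[_]_(d, n)) (a : G -> 'M[_]_n),
    [/\ t^t* *m t = 1%:M, (forall x : 'cV_n, t *m x \in V),
        (forall g, F g *m t = t *m a g) & irreducible_rep a].
Proof.
move=> V0 VF; have [U [U0 UV UF Umin]] := ex_minimal_stable V0 VF.
have [n [t [tt tU]]] := ex_orthonormal_basis U.
have tinj (p : nat) (x y : 'M[_]_(n, p)) : t *m x = t *m y -> x = y.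
  by move=> /(congr1 (fun z => t^t* *m z)); rewrite !mulmxA tt !mul1mx.
have Ft g : F g *m t = t *m (t^t* *m F g *m t).
  apply: eq_mulmx_cV => y; have [|x E] := (tU (F g *m (t *m y))).1.
    by apply: UF; apply/tU; exists y.
  by rewrite -!mulmxA E [t^t* *m _]mulmxA tt mul1mx.
exists n, t, (fun g => t^t* *m F g *m t); split=> //.
  by move=> x; apply: (subvP UV); apply/tU; exists x.
split.
  rewrite lt0n; apply/eqP => n0; apply: U0; apply/eqP; rewrite -subv0.
  apply/subvP => v /tU [x ->]; rewrite memv0; subst n.
  by rewrite [x]flatmx0 mulmx0.
move=> V' V'F; pose f := linfun (mulmx t : 'cV_n -> 'cV_d).
have fE x : f x = t *m x by rewrite lfunE.
have [||fV0|fVU] := Umin (f @: V')%VS.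
- by apply/subvP => _ /memv_imgP [x _ ->]; rewrite fE; apply/tU; exists x.
- move=> g _ /memv_imgP [x xV ->]; rewrite fE mulmxA Ft -mulmxA -fE.
  by apply: memv_img; apply: V'F.
- left; apply/eqP; rewrite -subv0; apply/subvP => x xV.
  have := memv_img f xV; rewrite fV0 !memv0 fE => /eqP tx0; apply/eqP.
  by apply: tinj; rewrite tx0 mulmx0.
- right; apply/eqP; rewrite eqEsubv subvf /=; apply/subvP => x _.
  have : t *m x \in U by apply/tU; exists x.
  by rewrite -fVU => /memv_imgP [y yV]; rewrite fE => /tinj ->.
Qed.

Lemma proj_unitary_subrep {R : realType} {G : groupType} {d n : nat}
    {alpha : G -> G -> R[i]} {F : G -> 'M[R[i]]_d} {t : 'M[R[i]]_(d, n)}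
    {a : G -> 'M[R[i]]_n} :
  proj_unitary_rep alpha F -> t^t* *m t = 1%:M ->
  (forall g, F g *m t = t *m a g) -> proj_unitary_rep alpha a.
Proof.
move=> [Fu FM] tt Ft; split=> [g|g h].
  exact: (isometry_intertwiner (Fu g) tt (Ft g)).1.
have E : t *m (a g *m a h) = t *m (alpha g h *: a (g * h)%g).
  by rewrite mulmxA -Ft -mulmxA -Ft mulmxA FM -scalemxAl Ft scalemxAr.
by rewrite -[LHS]mul1mx -[RHS]mul1mx -tt -!mulmxA E.
Qed.

Lemma schur {R : realType} {G : groupType} {n : nat} {r : G -> 'M[R[i]]_n}
    {A : 'M[R[i]]_n} :
  irreducible_rep r -> (forall h, r h *m A = A *m r h) -> exists c, A = c%:M.
Proof.
move=> [n0 rirr] rA.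
(* [eigenvalue] concerns row vectors, hence the transpose. The eigenspace [E] of [A] is nonzero and
   stable, so it is the whole space. *)
have [c /eigenvalueP [v vA v0]] := eigenvalue_closed A^T n0.
have [E EP] : exists E : {vspace 'cV[R[i]]_n},
    forall x, x \in E <-> A *m x = c *: x.
  apply: vspace_of_pred => [|a x y Ax Ay]; first by rewrite mulmx0 scaler0.
  by rewrite mulmxDr -scalemxAr Ax Ay scalerDr !scalerA mulrC.
have [|E0|Ef] := rirr E.
- by move=> h x /EP Ax; apply/EP; rewrite mulmxA -rA -mulmxA Ax -scalemxAr.
- have : v^T \in E by apply/EP; rewrite -[A]trmxK -trmx_mul vA linearZ.
  by rewrite E0 memv0 -(inj_eq trmx_inj) trmxK trmx0 (negPf v0).
- exists c; apply: eq_mulmx_cV => x; rewrite mul_scalar_mx.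
  by apply/EP; rewrite Ef memvf.
Qed.

(** * Tensor products acting on a row of blocks *)

Lemma sum_mxtens {V : nmodType} {m n : nat} (F : 'I_(m * n) -> V) :
  \sum_k F k = \sum_i \sum_j F (mxtens_index (i, j)).
Proof.
rewrite pair_bigA (reindex (@mxtens_index m n)) /=.
  by apply: eq_bigr => -[].
by exists (@mxtens_unindex m n) => x _; rewrite (mxtens_indexK, mxtens_unindexK).
Qed.

(** This is the matrix of the map sending the tensor of [e_j] and [x] to [T_j x], its columns being
    indexed as those of [tensmx]. *)
Definition block_row {C : Type} {d m n : nat} (T : 'I_m -> 'M[C]_(d, n)) :
    'M[C]_(d, m * n) :=
  \matrix_(a, k) T (mxtens_unindex k).1 a (mxtens_unindex k).2.

Lemma block_rowE {C : Type} {d m n : nat} (T : 'I_m -> 'M[C]_(d, n)) a i x :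
  block_row T a (mxtens_index (i, x)) = T i a x.
Proof. by rewrite mxE mxtens_indexK. Qed.

Lemma mul_block_row {C : pzRingType} {c d m n : nat} (A : 'M[C]_(c, d))
    (T : 'I_m -> 'M[C]_(d, n)) :
  A *m block_row T = block_row (fun i => A *m T i).
Proof.
apply/matrixP => a k; case: (mxtens_indexP k) => i x; rewrite block_rowE !mxE.
by apply: eq_bigr => b _; rewrite block_rowE.
Qed.

Lemma block_row_tensl {C : pzRingType} {d m n : nat} (T : 'I_m -> 'M[C]_(d, n))
    (l : 'M[C]_m) :
  block_row T *m tensmx l 1%:M = block_row (fun j => \sum_i T i *m (l i j)%:M).
Proof.
apply/matrixP => a k; case: (mxtens_indexP k) => j x; rewrite block_rowE mxE.
rewrite sum_mxtens summxE; apply: eq_bigr => i _; rewrite mxE.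
apply: eq_bigr => y _; rewrite block_rowE tensmxE !mxE -mulr_natr.
by case: eqP; rewrite ?(mulr1, mulr0, mulr1n, mulr0n).
Qed.

Lemma block_row_tensr {C : pzRingType} {d m n : nat} (T : 'I_m -> 'M[C]_(d, n))
    (r : 'M[C]_n) :
  block_row T *m tensmx 1%:M r = block_row (fun j => T j *m r).
Proof.
apply/matrixP => a k; case: (mxtens_indexP k) => j x; rewrite block_rowE !mxE.
rewrite sum_mxtens (bigD1 j) //= [X in _ + X]big1 ?addr0 => [|i /negPf ij].
  by apply: eq_bigr => y _; rewrite block_rowE tensmxE !mxE eqxx mul1r.
by rewrite big1 // => y _; rewrite tensmxE !mxE ij mul0r mulr0.
Qed.

Lemma block_row_isometry {C : numClosedFieldType} {d m n : nat}
    (T : 'I_m -> 'M[C]_(d, n)) :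
  (forall i j, (T i)^t* *m T j = (i == j)%:R%:M) ->
  (block_row T)^t* *m block_row T = 1%:M.
Proof.
move=> TT; apply/matrixP => k k'.
case: (mxtens_indexP k) => i x; case: (mxtens_indexP k') => j y.
have -> : ((block_row T)^t* *m block_row T) (mxtens_index (i, x))
    (mxtens_index (j, y)) = ((T i)^t* *m T j) x y.
  rewrite !mxE; apply: eq_bigr => a _; rewrite block_rowE; congr (_ * _).
  by rewrite mxE [in LHS]mxE block_rowE !mxE.
rewrite TT !mxE (inj_eq (can_inj (@mxtens_indexK m n))) xpair_eqE.
by case: eqP => _; case: eqP.
Qed.

(** * Splitting one irreducible tensor factor off a projector *)

Lemma ex_tensor_block {R : realType} {G : groupType} {d : nat}
    {beta alpha : G -> G -> R[i]} {L Rr : G -> 'M[R[i]]_d} {P : 'M[R[i]]_d} :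
  proj_unitary_rep beta L -> proj_unitary_rep alpha Rr ->
  P *m P = P -> (forall g, L g *m P = P *m L g) ->
  (forall h, Rr h *m P = P *m Rr h) ->
  (forall g h, L g *m Rr h *m P = Rr h *m L g *m P) -> P <> 0 ->
  exists m n (l : G -> 'M[R[i]]_m) (r : G -> 'M[R[i]]_n) (W : 'M[R[i]]_(d, m * n)),
    [/\ proj_unitary_rep beta l /\ irreducible_rep l,
        proj_unitary_rep alpha r /\ irreducible_rep r,
        W^t* *m W = 1%:M, P *m W = W &
        (forall g, L g *m W = W *m tensmx (l g) 1%:M) /\
        (forall h, Rr h *m W = W *m tensmx 1%:M (r h))].
Proof.
move=> hL hR PP PL PR PLR P0.
have [V VP] : exists V : {vspace 'cV[R[i]]_d}, forall v, v \in V <-> P *m v = v.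
  apply: vspace_of_pred => [|a u v Pu Pv]; first by rewrite mulmx0.
  by rewrite mulmxDr -scalemxAr Pu Pv.
have V0 : V <> 0%VS.
  move=> V0; apply: P0; apply: eq_mulmx_cV => x; rewrite mul0mx; apply/eqP.
  by rewrite -memv0 -V0; apply/VP; rewrite mulmxA PP.
have VR : stable V Rr.
  by move=> h v /VP Pv; apply/VP; rewrite mulmxA -PR -mulmxA Pv.
have [n [S [r [SS SV SR rirr]]]] := ex_irreducible_subrep V0 VR.
have hr := proj_unitary_subrep hR SS SR.
(* The intertwiners from [r] to [Rr] with range in that of [P]. *)
pose H (T : 'M[R[i]]_(d, n)) := P *m T = T /\ forall h, Rr h *m T = T *m r h.
have HS : H S.
  by split=> //; apply: eq_mulmx_cV => x; rewrite -mulmxA; apply/VP.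
have H0 : H 0 by split=> [|h]; rewrite ?mulmx0 ?mul0mx.
have HD a T T' : H T -> H T' -> H (a *: T + T').
  move=> [PT RT] [PT' RT']; split=> [|h].
    by rewrite mulmxDr -scalemxAr PT PT'.
  by rewrite mulmxDr mulmxDl -scalemxAr -scalemxAl RT RT'.
(* [L] and [Rr] commute only after [P], so [T] is first written as [P *m T]. *)
have HL g T : H T -> H (L g *m T).
  move=> [PT RT]; split=> [|h]; first by rewrite mulmxA -PL -mulmxA PT.
  by rewrite -[in LHS]PT !mulmxA -PLR -!mulmxA [P *m T]PT RT.
(* Unitarity turns the adjoint of the relation for [T] into one from [Rr] to [r], so the product
   commutes with [r]. *)
have Hscal T T' : H T -> H T' -> exists c, T^t* *m T' = c%:M.
  move=> [_ RT] [_ RT']; apply: (schur rirr) => h.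
  have rTR : r h *m T^t* = T^t* *m Rr h.
    have /unitarymxP rr := hr.1 h; have /unitarymxP RR := hR.1 (h : G).
    have RR' : (Rr h)^t* *m Rr h = 1%:M by apply: mulmx1C.
    have := congr1 (fun A => r h *m A^t* *m Rr h) (RT h).
    rewrite !adjmxM -!mulmxA RR' mulmx1 => ->.
    by rewrite !mulmxA rr mul1mx.
  by rewrite mulmxA rTR -!mulmxA RT'.
have [n0 _] := rirr.
pose e : 'cV[R[i]]_n := delta_mx (Ordinal n0) 0.
have ee : e^t* *m e = 1%:M.
  rewrite /e; apply/matrixP => i j; rewrite !ord1 !mxE (bigD1 (Ordinal n0)) //=.
  rewrite !mxE !eqxx /= conjC1 mul1r big1 ?addr0 // => k /negPf nk.
  by rewrite !mxE nk mulr0.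
(* If [T^t* T] is the scalar [c], then [c] is the squared norm of [T e]; it vanishes with [T e]. *)
have Hinj T : H T -> T *m e = 0 -> T = 0.
  move=> HT Te; have [c Tc] := Hscal T T HT HT; apply: adjmx_mul_eq0.
  have : e^t* *m (T^t* *m (T *m e)) = 0 by rewrite Te !mulmx0.
  rewrite [T^t* *m (T *m e)]mulmxA Tc mul_scalar_mx -scalemxAr ee scalemx1.
  by move=> /matrixP /(_ 0 0); rewrite !mxE eqxx mulr1n => ->; rewrite raddf0.
(* Evaluation at [e] realises the multiplicity space of [r] as a subspace of the column space, where
   [L] acts. *)
have [U UP] : exists U : {vspace 'cV[R[i]]_d},
    forall v, v \in U <-> exists T, H T /\ v = T *m e.
  apply: vspace_of_pred => [|a _ _ [T [HT ->]] [T' [HT' ->]]].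
    by exists 0; rewrite mul0mx.
  by exists (a *: T + T'); rewrite mulmxDl -scalemxAl; split=> //; apply: HD.
have U0 : U <> 0%VS.
  move=> U0; have : S *m e \in U by apply/UP; exists S.
  rewrite U0 memv0 => /eqP Se; have S0 := Hinj _ HS Se.
  move: SS; rewrite S0 mulmx0 => /matrixP /(_ (Ordinal n0) (Ordinal n0)) /eqP.
  by rewrite !mxE eqxx eq_sym oner_eq0.
have UL : stable U L.
  move=> g _ /UP [T [HT ->]]; apply/UP; exists (L g *m T).
  by rewrite mulmxA; split=> //; apply: HL.
have [m [t [l [tt tU tL lirr]]]] := ex_irreducible_subrep U0 UL.
have hl := proj_unitary_subrep hL tt tL.
have /boolp.choice [T HT] (j : 'I_m) :
    exists T : 'M[R[i]]_(d, n), H T /\ t *m delta_mx j 0 = T *m e.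
  by apply/UP/tU.
(* Both sides are intertwiners, so by [Hinj] they may be compared at [e], where the identity is
   column [j] of [L g *m t = t *m l g]. *)
have LT g j : L g *m T j = \sum_i T i *m (l g i j)%:M.
  apply/eqP; rewrite -subr_eq0; apply/eqP; apply: Hinj.
    have Hsum : H (\sum_i T i *m (l g i j)%:M).
      elim/big_ind: _ => // [A B HA HB|i _].
        by rewrite -[A]scale1r; apply: HD.
      by rewrite mul_mx_scalar -[_ *: _]addr0; apply: HD (HT i).1 H0.
    by rewrite addrC -scaleN1r; apply: HD Hsum (HL _ _ (HT j).1).
  rewrite mulmxBl -mulmxA -(HT j).2 mulmxA tL -mulmxA.
  have -> : l g *m delta_mx j 0 = \sum_i l g i j *: delta_mx i 0 :> 'cV_m.
    rewrite -colE; apply/colP => k; rewrite mxE summxE (bigD1 k) //= big1 => [|i ik].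
      by rewrite !mxE !eqxx mulr1 addr0.
    by rewrite !mxE eq_sym (negPf ik) mulr0.
  rewrite mulmx_sumr mulmx_suml -sumrB big1 // => i _.
  by rewrite -scalemxAr (HT i).2 mul_mx_scalar -scalemxAl subrr.
(* The scalar is found by pairing with [e]: it is the inner product of [T_i e] and [T_j e], that is,
   of columns [i] and [j] of the isometry [t]. *)
have TT i j : (T i)^t* *m T j = (i == j)%:R%:M.
  have [c Tc] := Hscal _ _ (HT i).1 (HT j).1; rewrite Tc.
  have : (T i *m e)^t* *m (T j *m e) = c%:M.
    rewrite adjmxM mulmxA -[_ *m _ *m T j]mulmxA Tc mul_mx_scalar.
    by rewrite -scalemxAl ee scalemx1.
  rewrite -(HT i).2 -(HT j).2 adjmxM mulmxA -[_ *m _ *m t]mulmxA tt mulmx1.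
  move=> /matrixP /(_ 0 0); rewrite !mxE eqxx mulr1n => <-; congr (_%:M).
  rewrite (bigD1 j) //= big1 ?addr0 => [|k /negPf nk]; last by rewrite !mxE nk mulr0.
  by rewrite !mxE !eqxx andbT mulr1 conjC_nat eq_sym.
exists m, n, l, r, (block_row T); split=> //.
- exact: block_row_isometry.
- rewrite mul_block_row; congr block_row; apply: funext => i.
  exact: (HT i).1.1.
- split=> g; rewrite mul_block_row ?block_row_tensl ?block_row_tensr;
    congr block_row; apply: funext => i.
    exact: LT.
  exact: (HT i).1.2.
Qed.

(** * Orthogonal decomposition of the range of a projector *)

Record tensor_block (R : realType) (G : groupType) (d : nat) := TensorBlock {
  lsize : nat;
  rsize : nat;
  lrep : G -> 'M[R[i]]_lsize;
  rrep : G -> 'M[R[i]]_rsize;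
  embed : 'M[R[i]]_(d, lsize * rsize)
}.
Arguments TensorBlock {R G d lsize rsize}.
Arguments lsize {R G d}.
Arguments rsize {R G d}.
Arguments lrep {R G d}.
Arguments rrep {R G d}.
Arguments embed {R G d}.

Definition tensor_subrep {R : realType} {G : groupType} {d : nat}
    (beta alpha : G -> G -> R[i]) (L Rr : G -> 'M[R[i]]_d)
    (b : tensor_block R G d) : Prop :=
  [/\ proj_unitary_rep beta (lrep b) /\ irreducible_rep (lrep b),
      proj_unitary_rep alpha (rrep b) /\ irreducible_rep (rrep b),
      (embed b)^t* *m embed b = 1%:M &
      forall g h, L g *m Rr h *m embed b = embed b *m tensmx (lrep b g) (rrep b h)].

(** Induction on the rank of [P]: the projector [Q] onto one block commutes with both actions, so
    [P - Q] satisfies the same hypotheses with smaller rank. *)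
Lemma ex_tensor_decomposition {R : realType} {G : groupType} {d : nat}
    {beta alpha : G -> G -> R[i]} {L Rr : G -> 'M[R[i]]_d} {P : 'M[R[i]]_d} :
  proj_unitary_rep beta L -> proj_unitary_rep alpha Rr ->
  P^t* = P -> P *m P = P -> (forall g, L g *m P = P *m L g) ->
  (forall h, Rr h *m P = P *m Rr h) ->
  (forall g h, L g *m Rr h *m P = Rr h *m L g *m P) ->
  exists M (b : 'I_M -> tensor_block R G d),
    [/\ forall k, tensor_subrep beta alpha L Rr (b k),
        forall k, P *m embed (b k) = embed (b k),
        forall j k, j != k -> (embed (b j))^t* *m embed (b k) = 0 &
        \sum_k embed (b k) *m (embed (b k))^t* = P].
Proof.
move=> hL hR; have [N] := ubnP (\rank P).
elim: N P => // N IHN P ltPN Padj PP PL PR PLR.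
have [->|/eqP P0] := eqVneq P 0.
  (* The family is empty; the block of size zero only serves as a value for a function on ['I_0]. *)
  exists 0%N, (fun=> @TensorBlock R G d 0 0 (fun=> 0) (fun=> 0) 0).
  by split=> [[]|[]|[]|] //; rewrite big_ord0.
have [m [n [l [r [W [hl hr WW PW [LW RW]]]]]]] :=
  ex_tensor_block hL hR PP PL PR PLR P0.
pose Q := W *m W^t*.
have Qadj : Q^t* = Q by rewrite /Q adjmxM trmxCK.
have PQ : P *m Q = Q by rewrite mulmxA PW.
have QP : Q *m P = Q by rewrite -[LHS]trmxCK adjmxM Padj Qadj PQ Qadj.
have QQ : Q *m Q = Q by rewrite /Q mulmxA -[W *m _ *m W]mulmxA WW mulmx1.
have LQ g : L g *m Q = Q *m L g := (isometry_intertwiner (hL.1 g) WW (LW g)).2.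
have RQ h : Rr h *m Q = Q *m Rr h := (isometry_intertwiner (hR.1 h) WW (RW h)).2.
have P'P : (P - Q) *m P = P - Q by rewrite mulmxBl PP QP.
have PP' : P *m (P - Q) = P - Q by rewrite mulmxBr PP PQ.
have Q0 : Q <> 0.
  move=> Q0; have W0 : W = 0.
    by rewrite -[W]mulmx1 -WW mulmxA -/Q Q0 mul0mx.
  have mn0 : (0 < m * n)%N by rewrite muln_gt0 hl.2.1 hr.2.1.
  move: WW; rewrite W0 mulmx0 => /matrixP /(_ (Ordinal mn0) (Ordinal mn0)) /eqP.
  by rewrite !mxE eqxx eq_sym oner_eq0.
have ltP'P : (\rank (P - Q)%R < \rank P)%N.
  have sP'P : ((P - Q)%R <= P)%MS by rewrite -P'P submxMl.
  rewrite ltn_neqAle mxrankS // andbT (mxrank_leqif_sup sP'P).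
  (* Equal row spaces would give [P = D (P - Q)], hence [P (P - Q) = P]; but this product is
     [P - Q], so [Q] would vanish. *)
  apply/negP => /submxP[D PE]; apply: Q0.
  have P'P' : (P - Q) *m (P - Q) = P - Q.
    by rewrite mulmxBl PP' mulmxBr QP QQ subrr subr0.
  have : P *m (P - Q) = P by rewrite {1}PE -mulmxA P'P'.
  by rewrite PP' => /eqP; rewrite -subr_eq0 addrAC subrr add0r oppr_eq0 => /eqP.
have [|||g|h|g h|M [b [bsub bP borth bsum]]] := IHN (P - Q).
- exact: leq_trans ltP'P ltPN.
- by rewrite linearB map_mxB /= Padj Qadj.
- by rewrite mulmxBl PP' mulmxBr QP QQ subrr subr0.
- by rewrite mulmxBr mulmxBl PL LQ.
- by rewrite mulmxBr mulmxBl PR RQ.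
- by rewrite -PP' !mulmxA PLR.
(* The other blocks lie in the range of [P - Q], which [W^t*] kills. *)
have Wb k : W^t* *m embed (b k) = 0.
  rewrite -bP mulmxA mulmxBr.
  have -> : W^t* *m P = W^t* by rewrite -[in LHS]Padj -adjmxM PW.
  by rewrite /Q mulmxA WW mul1mx subrr mul0mx.
exists M.+1, (fun k => if unlift ord0 k is Some j then b j else TensorBlock l r W).
split=> [k|k|j k|].
- case: unliftP => [j _|_]; first exact: bsub.
  by split=> // g h /=; rewrite -mulmxA RW mulmxA LW -mulmxA tensmx_mul mulmx1 mul1mx.
- case: unliftP => [j _|_]; last exact: PW.
  by rewrite -bP mulmxA PP'.
- case: (unliftP ord0 j) => [j' ->|->]; case: (unliftP ord0 k) => [k' ->|->] //= jk.
  + by apply: borth; rewrite (inj_eq lift_inj) in jk.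
  + by rewrite -[LHS]trmxCK adjmxM trmxCK Wb trmx0 map_mx0.
- rewrite big_ord_recl unlift_none /=.
  under eq_bigr do rewrite liftK.
  by rewrite bsum addrC subrK.
Qed.

(** * Local subspaces sufficient for matrix product vectors *)

Lemma trace_prod_in_tensor_power {R : realType} {I Q : finType} {D N : nat}
    (S : set (I -> R[i])) (A : I -> 'M[R[i]]_D) (f : Q -> I -> R[i])
    (E : Q -> 'M[R[i]]_D) :
  (forall q, S (f q)) -> (forall i, A i = \sum_q f q i *: E q) ->
  in_tensor_power S (fun s : N.-tuple I => \tr (\prod_(n < N) A (tnth s n))).
Proof.
move=> Sf AE.
(* Distributing the product of sums gives one term for each choice of an index [q] at every site: a
   product vector of values of [f], weighted by the trace of the product of the corresponding
   [E]. *)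
pose path (k : 'I_#|{: {ffun 'I_N -> Q}}|) : {ffun 'I_N -> Q} := enum_val k.
exists #|{: {ffun 'I_N -> Q}}|, (fun k => \tr (\prod_n E (path k n))),
  (fun k n => f (path k n)); split=> // s.
under eq_bigr do rewrite AE.
rewrite bigA_distr_bigA /= raddf_sum /=.
rewrite -(big_enum_val (fun F : {ffun 'I_N -> Q} => \tr (\prod_n E (F n)) *
  \prod_n f (F n) (tnth s n))) /=.
apply: eq_bigr => F _; rewrite mulrC -mxtraceZ; congr (\tr _).
elim/big_rec3: _ => [|n A1 c A2 _ ->]; first by rewrite scale1r.
by rewrite -[LHS]/(_ *m _) -scalemxAl -scalemxAr scalerA.
Qed.

Lemma mpv_suffices {R : realType} {D1 D2 d : nat}
    {B : 'I_d -> 'M[R[i]]_(D2, D1)} {V : {vspace 'cV[R[i]]_d}} :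
  (forall a b, \col_i B i a b \in V) -> suffices_for_mpv B V.
Proof.
move=> BV; split=> [e|dA A] N.
  subst D2; pose Q := ('I_D1 * 'I_D1)%type.
  apply: (@trace_prod_in_tensor_power R 'I_d Q D1 N _ _
    (fun q i => B i q.1 q.2) (fun q => delta_mx q.1 q.2)) => [q|i].
    by exists (\col_i B i q.1 q.2) => //; apply: funext => i; rewrite mxE.
  by rewrite castmx_id {1}[B i]matrix_sum_delta pair_bigA.
(* The contracted index between [A] and [B] is kept in [q]: each coefficient is then a single
   product of an entry of [A] and one of [B], as [block_vectors] requires, and not a sum of such
   products. *)
pose Q := ('I_D1 * ('I_D2 * 'I_D1))%type.
apply: (@trace_prod_in_tensor_power R ('I_dA * 'I_d)%type Q D1 N _
  (fun p => A p.1 *m B p.2)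
  (fun q p => A p.1 q.1 q.2.1 * B p.2 q.2.1 q.2.2)
  (fun q => delta_mx q.1 q.2.2)) => [q|[x i] /=].
  exists (\col_x A x q.1 q.2.1), (\col_i B i q.2.1 q.2.2) => //.
  by apply: funext => p; rewrite !mxE.
rewrite [LHS]matrix_sum_delta /=.
under eq_bigr => a _.
  under eq_bigr => c _ do rewrite mxE scaler_suml.
  rewrite exchange_big pair_bigA /=.
  over.
by rewrite pair_bigA.
Qed.

(** * Invariance of the span, and assembly of the blocks *)

Lemma stable_spanned {R : realType} {G : groupType} {I : finType} {d : nat}
    {v : I -> 'cV[R[i]]_d} {F : G -> 'M[R[i]]_d} :
  (forall g i, F g *m v i \in (\sum_j <[v j]>)%VS) ->
  stable (\sum_j <[v j]>)%VS F.
Proof.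
move=> Fv g w /memv_sumP [u uv ->]; rewrite mulmx_sumr; apply: memv_suml => i _.
have /vlineP [c ->] := uv i isT.
by rewrite -scalemxAr memvZ.
Qed.

(** Pairwise orthogonality makes the Gram matrix block diagonal. The sum of the [W_k W_k^t*] fixes
    each vector of [V], whose coordinates are thus the blocks [W_k^t* v]. *)
Lemma orthonormal_basis_mxrow {R : realType} {d M : nat} {V : {vspace 'cV[R[i]]_d}}
    {p : 'I_M -> nat} {W : forall k, 'M[R[i]]_(d, p k)} :
  (forall k, (W k)^t* *m W k = 1%:M) ->
  (forall j k, j != k -> (W j)^t* *m W k = 0) ->
  (forall v, v \in V <-> (\sum_k W k *m (W k)^t*) *m v = v) ->
  orthonormal_basis V (\mxrow_k W k).
Proof.
move=> Wiso Worth VP.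
have PW k : (\sum_j W j *m (W j)^t*) *m W k = W k.
  rewrite mulmx_suml (bigD1 k) //= -mulmxA Wiso mulmx1 big1 ?addr0 // => j jk.
  by rewrite -mulmxA Worth ?mulmx0.
split=> [|v].
  rewrite -(mxdiagZ 1) tr_mxrow.
  have -> : (\mxcol_k (W k)^T) ^ Num.conj = \mxcol_k (W k)^t*.
    by apply/matrixP => i j; rewrite !mxE.
  rewrite mul_mxcol_mxrow; apply: eq_mxblock => j k.
  by case: eqVneq => [->|jk]; [rewrite conform_mx_id Wiso | rewrite Worth].
rewrite VP; split=> [<-|[x ->]].
  exists (\mxcol_k ((W k)^t* *m v)); rewrite mul_mxrow_mxcol mulmx_suml.
  by apply: eq_bigr => k _; rewrite mulmxA.
by rewrite mulmxA mul_mxrow; congr (_ *m _); apply: eq_mxrow.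
Qed.

Theorem proposition2 (R : realType) (G : topGroupType)
    (hG : finite_set [set: G] \/ compact_lie_group R G)
    (d D1 D2 : nat) (gam : G -> G -> R[i]) (hgam : multiplier gam)
    (RR LL : G -> 'M[R[i]]_d)
    (hR : proj_unitary_rep gam RR)
    (hL : proj_unitary_rep (fun g h => (gam g h)^-1) LL)
    (B : 'I_d -> 'M[R[i]]_(D2, D1))
    (X : G -> 'M[R[i]]_D1) (Y : G -> 'M[R[i]]_D2)
    (hY : forall g, Y g \in unitmx)
    (hBX : forall g i, \sum_(i' < d) RR g i i' *: B i' = B i *m X g)
    (hBY : forall g i, \sum_(i' < d) LL g i i' *: B i' = invmx (Y g) *m B i) :
  exists V : {vspace 'cV[R[i]]_d},
    [/\ suffices_for_mpv B V,
        restricts_to_proj_unitary_rep V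
          (fun p q : G * G => (gam p.1 q.1)^-1 * gam p.2 q.2)
          (fun p : G * G => LL p.1 *m RR p.2)
      & exists (M : nat) (dl dr : 'I_M -> nat)
          (l : forall k, G -> 'M[R[i]]_(dl k))
          (r : forall k, G -> 'M[R[i]]_(dr k))
          (W : 'M[R[i]]_(d, \sum_(k < M) dl k * dr k)),
          [/\ orthonormal_basis V W,
              (forall k, proj_unitary_rep (fun g h => (gam g h)^-1) (l k) /\
                         irreducible_rep (l k)),
              (forall k, proj_unitary_rep gam (r k) /\ irreducible_rep (r k))
            & (forall g h, LL g *m RR h *m W =
                           W *m \mxdiag_(k < M) tensmx (l k g) (r k h))]].
Proof.
pose v (p : 'I_D2 * 'I_D1) : 'cV[R[i]]_d := \col_i B i p.1 p.2.
have Rv g p : RR g *m v p = \sum_c X g c p.2 *: v (p.1, c).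
  apply/colP => i; have /matrixP /(_ p.1 p.2) := hBX g i.
  rewrite !mxE !summxE => E; under eq_bigr do rewrite mxE.
  transitivity (\sum_j (RR g i j *: B j) p.1 p.2).
    by apply: eq_bigr => j _; rewrite mxE.
  by rewrite E; apply: eq_bigr => c _; rewrite !mxE mulrC.
have Lv g p : LL g *m v p = \sum_c invmx (Y g) p.1 c *: v (c, p.2).
  apply/colP => i; have /matrixP /(_ p.1 p.2) := hBY g i.
  rewrite !mxE !summxE => E; under eq_bigr do rewrite mxE.
  transitivity (\sum_j (LL g i j *: B j) p.1 p.2).
    by apply: eq_bigr => j _; rewrite mxE.
  by rewrite E; apply: eq_bigr => c _; rewrite !mxE.
pose V : {vspace 'cV[R[i]]_d} := (\sum_p <[v p]>)%VS.
have vV p : v p \in V by rewrite memvE (sumv_sup p).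
have VR : stable V RR.
  by apply: stable_spanned => g p; rewrite Rv; apply: memv_suml => c _; rewrite memvZ.
have VL : stable V LL.
  by apply: stable_spanned => g p; rewrite Lv; apply: memv_suml => c _; rewrite memvZ.
(* On the spanning vectors [RR] changes only the column index of [B] and [LL] only the row index, so
   the order is immaterial. *)
have LRC g h w : w \in V -> LL g *m (RR h *m w) = RR h *m (LL g *m w).
  move=> /memv_sumP [u uv ->]; rewrite !mulmx_sumr; apply: eq_bigr => p _.
  have /vlineP [c ->] := uv p isT; rewrite -!scalemxAr; congr (_ *: _).
  rewrite Rv Lv !mulmx_sumr.
  under eq_bigr => b _ do rewrite -scalemxAr Lv scaler_sumr.
  rewrite exchange_big /=; apply: eq_bigr => a _.
  rewrite -scalemxAr Rv scaler_sumr; apply: eq_bigr => b _.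
  by rewrite !scalerA mulrC.
have [n [t [tt tV]]] := ex_orthonormal_basis V.
pose P := t *m t^t*.
have VP w : w \in V <-> P *m w = w.
  split=> [/tV [x ->]|<-]; first by rewrite -mulmxA [_ *m (t *m x)]mulmxA tt mul1mx.
  by apply/tV; exists (t^t* *m w); rewrite mulmxA.
have PV x : P *m x \in V by apply/tV; exists (t^t* *m x); rewrite mulmxA.
have PP : P *m P = P by rewrite /P mulmxA -[t *m _ *m t]mulmxA tt mulmx1.
(* For a unitary action, invariance of [V] suffices for the orthogonal projector onto [V] to commute
   with it. *)
have PC F : (forall g : G, F g \is unitarymx) -> stable V F ->
    forall g, F g *m P = P *m F g.
  move=> Fu VF g.
  suff Ft : F g *m t = t *m (t^t* *m F g *m t).
    exact: (isometry_intertwiner (Fu g) tt Ft).2.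
  apply: eq_mulmx_cV => x; rewrite -!mulmxA [RHS]mulmxA; apply/esym/VP.
  by apply: VF; apply/tV; exists x.
have Padj : P^t* = P by rewrite /P adjmxM trmxCK.
have PLR g h : LL g *m RR h *m P = RR h *m LL g *m P.
  by apply: eq_mulmx_cV => x; rewrite -!mulmxA LRC // mulmxA.
have [M [b [bsub bP borth bsum]]] := ex_tensor_decomposition hL hR
  Padj PP (PC _ hL.1 VL) (PC _ hR.1 VR) PLR.
exists V; split.
- by apply: mpv_suffices => a c; apply: (vV (a, c)).
- split=> [p|p w Vw|p q w Vw].
  + by apply: mul_unitarymx; [apply: hL.1 | apply: hR.1].
  + by rewrite -mulmxA; apply/VL/VR.
  (* [RR p.2] is moved past [LL q.1], which is legitimate because [RR q.2 *m w] is still in [V]; the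
     two multipliers then combine. *)
  + rewrite -!mulmxA -LRC; last exact: VR.
    rewrite [RR p.2 *m _]mulmxA hR.2 -scalemxAl -!scalemxAr mulmxA hL.2.
    by rewrite -scalemxAl scalerA mulrC.
- exists M, (fun k => lsize (b k)), (fun k => rsize (b k)),
    (fun k => lrep (b k)), (fun k => rrep (b k)), (\mxrow_k embed (b k)); split.
  + apply: orthonormal_basis_mxrow => [k||w]; last by rewrite bsum.
      by case: (bsub k).
    exact: borth.
  + by move=> k; case: (bsub k).
  + by move=> k; case: (bsub k).
  + move=> g h; rewrite mul_mxrow mul_mxrow_mxdiag; apply: eq_mxrow => k.
    by case: (bsub k).
Qed.
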